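(* Let $r\ge 0$ be an integer and let $G$ be an automaton group generated by an automaton of degree $r$ (acting on some rooted tree $\mathbb T_{m_0}$). Then there is an integer $m$ such that $G$ is isomorphic to a subgroup of the mother group $\mathfrak M_{m,r}$.
   Context: For $m\ge2$, $\mathbb T_m$ is the rooted $m$-ary tree of finite words over $\{0,\dots,m-1\}$ (children of $w$ are $wx$); $\operatorname{Aut}(\mathbb T_m)$ acts on the right. We write $g=\langle\langle g_0,\dots,g_{m-1}\rangle\rangle\sigma$ with $g_i\in\operatorname{Aut}(\mathbb T_m)$, $\sigma\in\operatorname{Sym}(m)$ (the symmetric group of $\{0,\dots,m-1\}$), to mean $(xw).g=(x.\sigma)(w.g_x)$ for every letter $x$ and word $w$; $g_x=g(x)$ is the first-level section, and more generally the section $g(v)$ at a word $v$ satisfies $(vw).g=(v.g)(w.g(v))$. A permutation $\sigma\in \operatorname{Sym}(m)$ is identified with $\langle\langle1,\dots,1\rangle\rangle\sigma$. An automaton is a finite subset $A\subset\operatorname{Aut}(\mathbb T_m)$ closed under taking first-level sections; its automaton group is $\langle A\rangle$. For $a\in A$ let $N_a(n)$ be the number of words $v$ of length $n$ with $a(v)\ne1$; $N_a(n)$ is eventually $0$, or grows polynomially of some degree $d\ge 0$ (lies between positive constant multiples of $n^d$ for large $n$), or grows exponentially, and the degree of $a$ is respectively $-1$, $d$, $\infty$. The degree of the automaton is the maximum of the degrees of its elements. The mother group $\mathfrak M_{m,r}$ is the subgroup of $\operatorname{Aut}(\mathbb T_m)$ generated by the following recursively defined elements, where $\sigma,\rho$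 range over $\operatorname{Sym}(m)$ with $0.\rho=0$: $\alpha_{-1,\sigma}=\sigma$; $\alpha_{k,\sigma}=\langle\langle\alpha_{k,\sigma},\alpha_{k-1,\sigma},1,\dots,1\rangle\rangle$ for $0\le k\le r$; $\beta_{0,\rho}=\langle\langle\beta_{0,\rho},1,\dots,1\rangle\rangle\rho$; $\beta_{k,\rho}=\langle\langle\beta_{k,\rho},\beta_{k-1,\rho},1,\dots,1\rangle\rangle$ for $1\le k\le r$. *)

(* Defs.v *)
From HB Require Import structures.
From mathcomp Require Import all_boot all_order all_fingroup all_algebra.
From mathcomp Require Import boolp classical_sets functions cardinality.
From mathcomp Require Import constructive_ereal.

Set Implicit Arguments.
Unset Strict Implicit.
Unset Printing Implicit Defensive.

Import Order.TTheory GRing.Theory Num.Theory.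

Local Open Scope classical_set_scope.
Local Open Scope group_scope.

Section AbstractGroups.

Definition is_subgroup (gT : groupType) (G : set gT) : Prop :=
  group_closed (fun x : gT => x \in G).

Definition generated_subgroup (gT : groupType) (A : set gT) : set gT :=
  smallest (@is_subgroup gT) A.

Definition isomorphic_subgroups (gT hT : groupType)
    (G : set gT) (H : set hT) : Prop :=
  exists2 phi : gT -> hT,
    {in G &, {morph phi : x y / x * y}} & set_bij G H phi.

End AbstractGroups.

Section TreeAutomorphisms.
Variable m : nat.

(* A vertex of the rooted m-ary tree; the children of [w] are [rcons w x]. *)
Definition word := seq 'I_m.

Definition is_tree_aut (f : word -> word) : Prop :=
  [/\ bijective f, f [::] = [::]
    & forall w x, exists y, f (rcons w x) = rcons (f w) y].

(* The group acts on the right: [g w] stands for w.g, hence the product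
   [g * h] is "first g, then h", as for the permutations of [perm]. *)
Record tree_aut := TreeAut {
  tree_fun :> word -> word;
  tree_autP : is_tree_aut tree_fun }.

Lemma tree_autE (g h : tree_aut) : (forall w, g w = h w) -> g = h.
Proof.
case: g h => [f fP] [f' f'P] /= e.
have {}e : f = f' by apply/funext.
by move: fP; rewrite e => fP; rewrite (Prop_irrelevance fP f'P).
Qed.

HB.instance Definition _ := gen_eqMixin tree_aut.
HB.instance Definition _ := gen_choiceMixin tree_aut.

Lemma tree_aut_size (g : tree_aut) w : size (g w) = size w.
Proof.
have [_ g0 gS] := tree_autP g.
elim/last_ind: w => [|w x IHw]; first by rewrite g0.
by have [y ->] := gS w x; rewrite !size_rcons IHw.
Qed.

Lemma tree_aut_cat (g : tree_aut) v w : take (size v) (g (v ++ w)) = g v.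
Proof.
have [_ g0 gS] := tree_autP g.
elim/last_ind: w => [|w x IHw].
  by rewrite cats0 -(tree_aut_size g v) take_size.
rewrite -rcons_cat; have [y ->] := gS (v ++ w) x.
by rewrite -cats1 takel_cat ?IHw // tree_aut_size size_cat leq_addr.
Qed.

Lemma tree_aut_bij (g : tree_aut) : bijective g.
Proof. by have [] := tree_autP g. Qed.

Lemma is_tree_autP (f : word -> word) :
    bijective f -> (forall w, size (f w) = size w) ->
    (forall v w, take (size v) (f (v ++ w)) = f v) -> is_tree_aut f.
Proof.
move=> bf sf tf; split=> // [|w x]; first by apply: size0nil; rewrite sf.
have := tf w [:: x]; have := sf (w ++ [:: x]); rewrite cats1 size_rcons.
case/lastP: (f _) => // u y; rewrite size_rcons => -[su].
rewrite -cats1 takel_cat ?su // -su take_size => <-.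
by exists y; rewrite cats1.
Qed.

Lemma tree_one_subproof : is_tree_aut id.
Proof.
apply: is_tree_autP => // [|v w]; first by exists id.
by rewrite take_size_cat.
Qed.
Definition tree_one := TreeAut tree_one_subproof.

Lemma tree_mul_subproof (g h : tree_aut) : is_tree_aut (h \o g).
Proof.
apply: is_tree_autP => [|w|v w] /=.
- exact: bij_comp (tree_aut_bij h) (tree_aut_bij g).
- by rewrite !tree_aut_size.
- rewrite -(cat_take_drop (size v) (g (v ++ w))) tree_aut_cat.
  by rewrite -[in take _](tree_aut_size g v) tree_aut_cat.
Qed.
Definition tree_mul (g h : tree_aut) := TreeAut (tree_mul_subproof g h).

Lemma tree_inv_exists (g : tree_aut) :
  {f : word -> word | cancel g f /\ cancel f g}.
Proof. by apply: cid; have [f gK fK] := tree_aut_bij g; exists f. Qed.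

Lemma tree_inv_subproof (g : tree_aut) :
  is_tree_aut (projT1 (tree_inv_exists g)).
Proof.
case: (tree_inv_exists g) => f [gK fK] /=.
have sf w : size (f w) = size w by rewrite -[in RHS](fK w) tree_aut_size.
apply: is_tree_autP => // [|v w]; first by exists g.
apply: (can_inj gK); rewrite fK.
rewrite -(tree_aut_cat g _ (drop (size v) (f (v ++ w)))) cat_take_drop fK.
by rewrite size_takel ?sf ?size_cat ?leq_addr // take_size_cat.
Qed.
Definition tree_inv (g : tree_aut) := TreeAut (tree_inv_subproof g).

Lemma tree_mulA : associative tree_mul.
Proof. by move=> f g h; apply: tree_autE. Qed.

Lemma tree_mul1 : left_id tree_one tree_mul.
Proof. by move=> g; apply: tree_autE. Qed.

Lemma tree_mulr1 : right_id tree_one tree_mul.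
Proof. by move=> g; apply: tree_autE. Qed.

Lemma tree_mulV : left_inverse tree_one tree_inv tree_mul.
Proof.
by move=> g; apply: tree_autE => w /=; case: (tree_inv_exists g) => f [].
Qed.

Lemma tree_mulrV : right_inverse tree_one tree_inv tree_mul.
Proof.
by move=> g; apply: tree_autE => w /=; case: (tree_inv_exists g) => f [].
Qed.

HB.instance Definition _ :=
  isGroup.Build tree_aut tree_mulA tree_mul1 tree_mulr1 tree_mulV tree_mulrV.

Lemma tree_autK (g : tree_aut) : cancel g (g^-1)%g.
Proof. by move=> w; rewrite -[LHS]/((g * g^-1) w) mulgV. Qed.

Lemma tree_autVK (g : tree_aut) : cancel (g^-1)%g g.
Proof. by move=> w; rewrite -[LHS]/((g^-1 * g) w) mulVg. Qed.

Lemma section_subproof (g : tree_aut) (v : word) :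
  is_tree_aut (fun w => drop (size v) (g (v ++ w))).
Proof.
have gE w : g (v ++ w) = g v ++ drop (size v) (g (v ++ w)).
  by rewrite -{1}(cat_take_drop (size v) (g (v ++ w))) tree_aut_cat.
have sD w : size (drop (size v) (g (v ++ w))) = size w.
  by rewrite size_drop tree_aut_size size_cat addKn.
have [f gK fK] := tree_aut_bij g.
have fE w : f (g v ++ w) = v ++ drop (size v) (f (g v ++ w)).
  set u := f _; rewrite -[LHS](cat_take_drop (size v) u); congr (_ ++ _).
  apply: (can_inj gK).
  rewrite -(tree_aut_cat g _ (drop (size v) u)) cat_take_drop fK size_takel.
    by rewrite -(tree_aut_size g v) take_size_cat.
  by rewrite -(tree_aut_size g u) fK size_cat tree_aut_size leq_addr.
apply: is_tree_autP => // [|u w].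
- exists (fun w => drop (size v) (f (g v ++ w))) => w.
    by rewrite -gE gK drop_size_cat.
  by rewrite -fE fK drop_size_cat ?tree_aut_size.
- by rewrite take_drop addnC -size_cat catA tree_aut_cat.
Qed.
(* [section g v] is the section g(v). *)
Definition section (g : tree_aut) (v : word) := TreeAut (section_subproof g v).

Lemma sectionE (g : tree_aut) (v w : word) : g (v ++ w) = g v ++ section g v w.
Proof. by rewrite /= -{1}(tree_aut_cat g v w) cat_take_drop. Qed.

Definition wreath_fun (s : 'I_m -> word -> word) (sigma : 'S_m) (w : word) :=
  if w is x :: w' then sigma x :: s x w' else [::].

Lemma wreath_subproof (s : 'I_m -> tree_aut) (sigma : 'S_m) :
  is_tree_aut (wreath_fun s sigma).
Proof.
apply: is_tree_autP => [|[|x w]|[|x v] w] //=.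
- exists (fun w => if w is x :: w' then
      sigma^-1%g x :: (s (sigma^-1%g x))^-1%g w' else [::]).
  + by case=> [//|x w]; rewrite /wreath_fun permK tree_autK.
  + by case=> [//|x w]; rewrite /wreath_fun permKV tree_autVK.
- by rewrite tree_aut_size.
- by rewrite take0.
- by rewrite tree_aut_cat.
Qed.
(* [wreath s sigma] is << s 0, ..., s (m-1) >> sigma. *)
Definition wreath (s : 'I_m -> tree_aut) (sigma : 'S_m) :=
  TreeAut (wreath_subproof s sigma).

End TreeAutomorphisms.

Section Automata.
Variable m : nat.

Definition is_automaton (A : set (tree_aut m)) : Prop :=
  finite_set A /\ forall a (x : 'I_m), A a -> A (section a [:: x]).

Definition nontrivial_sections (a : tree_aut m) (n : nat) : nat :=
  #|[pred v : n.-tuple 'I_m | section a v != 1]|.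

(* Degrees live in \bar int; only -1, the natural numbers and +oo occur.
   The constants of the polynomial and exponential bounds are taken rational,
   which is no restriction. No upper bound is needed in the exponential case
   since there are only m ^ n words of length n. *)
Inductive growth_degree (N : nat -> nat) : \bar int -> Prop :=
| growth_null n0 :
    (forall n, n0 <= n -> N n = 0%N)%N ->
    growth_degree N (- 1 : int)%R%:E
| growth_poly (d : nat) (c C : rat) n0 :
    (0 < c)%R -> (0 < C)%R ->
    (forall n, (n0 <= n)%N ->
       (c * n%:R ^+ d <= (N n)%:R <= C * n%:R ^+ d)%R) ->
    growth_degree N (d%:Z)%:E
| growth_exp (c lambda : rat) n0 :
    (0 < c)%R -> (1 < lambda)%R ->
    (forall n, (n0 <= n)%N -> (c * lambda ^+ n <= (N n)%:R)%R) ->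
    growth_degree N +oo%E.

Definition has_degree (a : tree_aut m) (e : \bar int) : Prop :=
  growth_degree (nontrivial_sections a) e.

(* [e] is the maximum of the degrees of the elements of [A]. *)
Definition automaton_has_degree (A : set (tree_aut m)) (e : \bar int) : Prop :=
  (exists2 a, A a & has_degree a e) /\
  (forall a, A a -> exists2 d, has_degree a d & (d <= e)%E).

End Automata.

Section MotherGroup.
Variable m : nat.
Implicit Types (sigma rho : 'S_m) (w : word m).

(* The index is shifted by one: [alpha j sigma] is alpha_{j-1,sigma}. The
   defining recursions are [alpha0E], [alphaSE], [beta0E] and [betaSE]. *)
Fixpoint alpha_fun sigma (j : nat) w : word m :=
  if w is x :: w' then
    if j is i.+1 then
      x :: (if val x == 0%N then alpha_fun sigma j w'
            else if val x == 1%N then alpha_fun sigma i w' else w')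
    else sigma x :: w'
  else [::].

Fixpoint beta_fun rho (k : nat) w : word m :=
  if w is x :: w' then
    if k is i.+1 then
      x :: (if val x == 0%N then beta_fun rho k w'
            else if val x == 1%N then beta_fun rho i w' else w')
    else rho x :: (if val x == 0%N then beta_fun rho 0 w' else w')
  else [::].

Fixpoint beta_inv_fun rho (k : nat) w : word m :=
  if w is x :: w' then
    if k is i.+1 then
      x :: (if val x == 0%N then beta_inv_fun rho k w'
            else if val x == 1%N then beta_inv_fun rho i w' else w')
    else let y := rho^-1%g x in
      y :: (if val y == 0%N then beta_inv_fun rho 0 w' else w')
  else [::].

Lemma alpha_funK sigma j : cancel (alpha_fun sigma j) (alpha_fun sigma^-1%g j).
Proof.
move=> w; elim: w j => [|x w IHw] [|i] //=; first by rewrite permK.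
by congr (_ :: _); case: (val x) => [|[|?]] /=; rewrite ?IHw.
Qed.

Lemma beta_funK rho k : cancel (beta_fun rho k) (beta_inv_fun rho k).
Proof.
move=> w; elim: w k => [|x w IHw] [|i] //=.
  by rewrite permK; congr (_ :: _); case: (val x) => [|?] /=; rewrite ?IHw.
by congr (_ :: _); case: (val x) => [|[|?]] /=; rewrite ?IHw.
Qed.

Lemma beta_inv_funK rho k : cancel (beta_inv_fun rho k) (beta_fun rho k).
Proof.
move=> w; elim: w k => [|x w IHw] [|i] //=.
  by rewrite permKV; congr (_ :: _); case: eqP; rewrite ?IHw.
by congr (_ :: _); case: (val x) => [|[|?]] /=; rewrite ?IHw.
Qed.

Lemma alpha_subproof sigma j : is_tree_aut (alpha_fun sigma j).
Proof.
apply: is_tree_autP.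
- exists (alpha_fun sigma^-1%g j); first exact: alpha_funK.
  by move=> w; rewrite -{1}[sigma]invgK alpha_funK.
- move=> w; elim: w j => [|x w IHw] [|i] //=.
  by case: (val x) => [|[|?]] /=; rewrite ?IHw.
- move=> v w; elim: v j => [|x v IHv] j; first by rewrite take0; case: j.
  case: j => [|i] /=; first by rewrite take_size_cat.
  by case: (val x) => [|[|?]] /=; rewrite ?IHv ?take_size_cat.
Qed.
Definition alpha (j : nat) sigma := TreeAut (alpha_subproof sigma j).

Lemma beta_subproof rho k : is_tree_aut (beta_fun rho k).
Proof.
apply: is_tree_autP.
- by exists (beta_inv_fun rho k); [exact: beta_funK|exact: beta_inv_funK].
- move=> w; elim: w k => [|x w IHw] [|i] //=.
    by case: (val x) => [|?] /=; rewrite ?IHw.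
  by case: (val x) => [|[|?]] /=; rewrite ?IHw.
- move=> v w; elim: v k => [|x v IHv] k; first by rewrite take0; case: k.
  case: k => [|i] /=.
    by case: (val x) => [|?] /=; rewrite ?IHv ?take_size_cat.
  by case: (val x) => [|[|?]] /=; rewrite ?IHv ?take_size_cat.
Qed.
Definition beta (k : nat) rho := TreeAut (beta_subproof rho k).

Lemma alpha0E sigma : alpha 0 sigma = wreath (fun=> 1) sigma.
Proof. by apply: tree_autE => -[]. Qed.

Lemma alphaSE j sigma :
  alpha j.+1 sigma =
    wreath (fun x => if val x == 0%N then alpha j.+1 sigma
                     else if val x == 1%N then alpha j sigma else 1) 1.
Proof.
apply: tree_autE => -[|x w] //=; rewrite perm1.
by case: (val x) => [|[|?]].
Qed.

Lemma beta0E rho :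
  beta 0 rho = wreath (fun x => if val x == 0%N then beta 0 rho else 1) rho.
Proof. by apply: tree_autE => -[|x w] //=; case: (val x). Qed.

Lemma betaSE k rho :
  beta k.+1 rho =
    wreath (fun x => if val x == 0%N then beta k.+1 rho
                     else if val x == 1%N then beta k rho else 1) 1.
Proof.
apply: tree_autE => -[|x w] //=; rewrite perm1.
by case: (val x) => [|[|?]].
Qed.

Definition mother_generators (r : nat) : set (tree_aut m) :=
  [set g | exists j sigma, (j <= r.+1)%N /\ g = alpha j sigma] `|`
  [set g | exists k rho, [/\ (k <= r)%N,
     forall x : 'I_m, val x = 0%N -> rho x = x & g = beta k rho]].

Definition mother_group (r : nat) : set (tree_aut m) :=
  generated_subgroup (mother_generators r).

End MotherGroup.

Arguments mother_generators m r : clear implicits.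
Arguments mother_group m r : clear implicits.

(* Main.v *)
Require Import Defs.
From mathcomp Require Import all_boot all_order all_fingroup all_algebra.
From mathcomp Require Import boolp classical_sets functions cardinality.
From mathcomp Require Import constructive_ereal.
From mathcomp Require Import zify.

Set Implicit Arguments.
Unset Strict Implicit.
Unset Printing Implicit Defensive.

(* Group the letters of the given tree into blocks of length 2N, where N is a
   multiple of all the periods of the automaton and at least the depth of
   its finitary states.  A state [a] of degree d >= 0 then either satisfies
   a(u) = a for some word u of length N, all sections at blocks other than uu
   having degree < d, or has only sections of degree < d and sections of the
   former kind.  Relabel the children of a vertex so that the label 0 is given
   to the block pp, where p is the suffix of length N of the preceding block:
   periodic paths become 000..., fixed by the recoded automaton.  Finally double
   the alphabet, with trivial action below the second copy; all local
   permutations become products of double transpositions.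

   The subgroup of the mother group generated by the alpha_{k,s} and beta_{k,s}
   with s a double transposition contains every << g_0, ..., g_{m-1} >> s with
   g_x in it and s even, since double transpositions are commutators.  It also
   contains b = << b, g_1, ..., g_{m-1} >> s with s even fixing 0 and the g_x in
   the group of the previous level.  By induction on the degree it contains the
   recoded automaton. *)

(** * The even part of the mother group *)

Section DoubleTranspositions.
Local Open Scope group_scope.
Variable T : finType.
Implicit Types (P : pred T) (s t : {perm T}).

Definition dtransp P s := exists a b c d,
  [/\ uniq [:: a; b; c; d], all P [:: a; b; c; d] & s = tperm a b * tperm c d].

Inductive dtransp_prod P : {perm T} -> Prop :=
| dtransp_prod1 : dtransp_prod P 1
| dtransp_prodM s t :
    dtransp P s -> dtransp_prod P t -> dtransp_prod P (s * t).

Lemma dtransp_prod_gen P s : dtransp P s -> dtransp_prod P s.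
Proof. by move=> Ps; rewrite -[s]mulg1; apply: dtransp_prodM => //; left. Qed.

Lemma dtransp_prod_mul P s t :
  dtransp_prod P s -> dtransp_prod P t -> dtransp_prod P (s * t).
Proof.
elim=> [|u v Pu _ IHv] Pt; first by rewrite mul1g.
by rewrite -mulgA; apply: dtransp_prodM => //; apply: IHv.
Qed.

Lemma dtransp_fix P s x : dtransp P s -> ~~ P x -> s x = x.
Proof.
move=> [a [b [c [d [_ /and5P[Pa Pb Pc Pd _] ->]]]]] Px.
by rewrite permM !tpermD //; apply: contraNneq Px => <-.
Qed.

Lemma exists_notin P (l : seq T) : size l < #|P| -> exists2 x, P x & x \notin l.
Proof.
move=> lP; apply/exists_inP; apply: contraTT lP => /exists_inPn h.
rewrite -leqNgt (leq_trans _ (card_size l)) // subset_leq_card //.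
by apply/fintype.subsetP => x /h; rewrite negbK.
Qed.

(** Six points leave room for a spare transposition (e f). Conjugation by (a c)(b d) fixes (e f) and
    turns (a b) into (c d), so the commutator of (e f)(a b) with it is (a b)(c d). *)
Lemma dtransp_comm P s : 5 < #|P| -> dtransp P s ->
  exists x y, [/\ dtransp P x, dtransp P y & s = [~ x, y]].
Proof.
move=> P6 [a [b [c [d [u /and5P[Pa Pb Pc Pd _] ->]]]]].
have [e Pe ne] : exists2 e, P e & e \notin [:: a; b; c; d].
  by apply: exists_notin; apply: leq_trans P6.
have [f Pf nf] : exists2 f, P f & f \notin [:: e; a; b; c; d].
  exact: exists_notin.
have {u ne nf} : uniq [:: f; e; a; b; c; d]
  by rewrite cons_uniq nf cons_uniq ne.
rewrite /= !inE !negb_or => /and5P[/and5P[fe fa fb fc fd] /and4P[ea eb ec ed]].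
move=> /and3P[ab ac ad] /andP[bc bd] /andP[cd _].
exists (tperm e f * tperm a b), (tperm a c * tperm b d); split.
- exists e, f, a, b; split=> //=; last by rewrite Pe Pf Pa Pb.
  by rewrite !inE (eq_sym e f) !negb_or fe ea eb fa fb ab.
- exists a, c, b, d; split=> //=; last by rewrite Pa Pb Pc Pd.
  by rewrite !inE !negb_or ac ab ad (eq_sym c b) bc cd bd.
have je : (tperm e f) ^ (tperm a c * tperm b d) = tperm e f.
  by rewrite tpermJ !permM !(tpermD (z := e)) ?(tpermD (z := f)) //;
     rewrite eq_sym.
have ja : (tperm a b) ^ (tperm a c * tperm b d) = tperm c d.
  rewrite tpermJ !permM tpermL (tpermD (z := b)) // 1?(eq_sym c) // tpermL.
  by rewrite tpermD // eq_sym.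
by rewrite commgEl conjMg je ja invMg !tpermV -mulgA tpermKg.
Qed.

End DoubleTranspositions.

Section Wreath.
Local Open Scope group_scope.
Variable m : nat.
Implicit Types (f g : 'I_m -> tree_aut m) (s t : 'S_m) (a b : tree_aut m).

Lemma wreathM f g s t :
  wreath f s * wreath g t = wreath (fun x => f x * g (s x)) (s * t).
Proof. by apply: tree_autE => -[|x w] //=; rewrite permM. Qed.

Lemma wreath1 : wreath (fun=> 1) 1 = 1 :> tree_aut m.
Proof. by apply: tree_autE => -[|x w] //=; rewrite perm1. Qed.

Lemma eq_wreath f g s : f =1 g -> wreath f s = wreath g s.
Proof. by move=> fg; apply: tree_autE => -[|x w] //=; rewrite fg. Qed.

Lemma wreathV f : (wreath f 1)^-1 = wreath (fun x => (f x)^-1) 1.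
Proof.
apply: mulg1_eq; rewrite wreathM mulg1 -wreath1.
by apply: eq_wreath => x; rewrite perm1 mulgV.
Qed.

Lemma wreathR f g :
  [~ wreath f 1, wreath g 1] = wreath (fun x => [~ f x, g x]) 1.
Proof.
rewrite commgEl conjgE !wreathV !wreathM !mulg1.
by apply: eq_wreath => x; rewrite !perm1.
Qed.

Definition single (x : 'I_m) a := wreath (fun y => if y == x then a else 1) 1.

Lemma singleM x a b : single x (a * b) = single x a * single x b.
Proof.
rewrite wreathM mulg1; apply: eq_wreath => y.
by rewrite perm1; case: eqP; rewrite ?mulg1.
Qed.

Lemma single1 x : single x 1 = 1.
Proof. by rewrite -[RHS]wreath1; apply: eq_wreath => y; case: ifP. Qed.

Lemma singleV x a : single x a^-1 = (single x a)^-1.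
Proof. by symmetry; apply: mulg1_eq; rewrite -singleM mulgV single1. Qed.

Lemma wreathJ f s : wreath f 1 ^ alpha 0 s = wreath (fun x => f (s^-1 x)) 1.
Proof.
have aV : (alpha 0 s)^-1 = alpha 0 s^-1.
  apply: mulg1_eq; rewrite !alpha0E wreathM mulgV -[RHS]wreath1.
  by apply: eq_wreath => x; rewrite mulg1.
rewrite conjgE aV !alpha0E !wreathM mul1g mulVg.
by apply: eq_wreath => x; rewrite mul1g mulg1.
Qed.

Lemma singleR x f g : (forall y, y != x -> f y = 1 \/ g y = 1) ->
  single x [~ f x, g x] = [~ wreath f 1, wreath g 1].
Proof.
move=> fg; rewrite wreathR; apply: eq_wreath => y; case: eqVneq => [->//|/fg].
by case=> ->; rewrite ?comm1g ?commg1.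
Qed.

End Wreath.

Section EvenMotherGroup.
Local Open Scope group_scope.
Variable m : nat.
Implicit Types (f g : 'I_m -> tree_aut m) (s t : 'S_m) (a b : tree_aut m).

Definition nonzero : pred 'I_m := fun x => val x != 0%N.

Lemma alphaM j s t : alpha j (s * t) = alpha j s * alpha j t.
Proof.
apply: tree_autE => w /=; elim: w j => [|x w IHw] [|j] //=.
  by rewrite permM.
by case: (val x) => [|[|?]] /=; rewrite ?IHw.
Qed.

Lemma betaM k s t : (forall x, ~~ nonzero x -> s x = x) ->
  beta k (s * t) = beta k s * beta k t.
Proof.
(* As [s] fixes 0, a letter is 0 exactly when its image is, so both factors recurse at the same
   letters. *)
move=> s0; have s0E x : (val (s x) == 0%N) = (val x == 0%N).
  apply/eqP/eqP => [sx|x0]; last by rewrite s0 // /nonzero x0.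
  suff <- : s x = x by [].
  by apply: (@perm_inj _ s); rewrite s0 // /nonzero sx.
apply: tree_autE => w /=; elim: w k => [|x w IHw] [|k] //=.
  by rewrite permM s0E; case: eqP; rewrite ?IHw.
by case: (val x) => [|[|?]] /=; rewrite ?IHw.
Qed.

Lemma alpha1 j : alpha j (1 : 'S_m) = 1.
Proof. by apply: (@mulgI _ (alpha j 1)); rewrite -alphaM !mulg1. Qed.

Lemma beta1 k : beta k (1 : 'S_m) = 1.
Proof.
by apply: (@mulgI _ (beta k 1)); rewrite -betaM ?mulg1 // => x; rewrite perm1.
Qed.

Lemma alphaV j s : alpha j s^-1 = (alpha j s)^-1.
Proof. by symmetry; apply: mulg1_eq; rewrite -alphaM mulgV alpha1. Qed.

Lemma betaV k s : (forall x, ~~ nonzero x -> s x = x) ->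
  beta k s^-1 = (beta k s)^-1.
Proof.
by move=> s0; symmetry; apply: mulg1_eq; rewrite -betaM // mulgV beta1.
Qed.

Lemma alphaR j s t : alpha j [~ s, t] = [~ alpha j s, alpha j t].
Proof. by rewrite !commgEl !conjgE !alphaM !alphaV. Qed.

Lemma betaR k s t : (forall x, ~~ nonzero x -> s x = x) ->
  (forall x, ~~ nonzero x -> t x = x) ->
  beta k [~ s, t] = [~ beta k s, beta k t].
Proof.
have fV (u : 'S_m) x : u x = x -> u^-1 x = x.
  by move=> ux; apply: (@perm_inj _ u); rewrite permKV ux.
move=> s0 t0; rewrite !commgEl !conjgE !betaM ?betaV //.
- by move=> x /t0/fV.
- by move=> x /s0/fV.
Qed.

(* For large [m] every double transposition is a commutator of double
   transpositions; restricting the generators to them removes the sign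
   obstruction to the branching property [evenM_wreath]. *)
Inductive evenM (k : nat) : tree_aut m -> Prop :=
| evenM1 : evenM k 1
| evenMM a b : evenM k a -> evenM k b -> evenM k (a * b)
| evenMV a : evenM k a -> evenM k a^-1
| evenM_alpha j s : j <= k -> dtransp predT s -> evenM k (alpha j s)
| evenM_beta i s : i < k -> dtransp nonzero s -> evenM k (beta i s).

(** The shift comes from [alpha j] standing for alpha_{j-1}; in particular level 0 consists of root
    permutations only. *)
Lemma evenM_mother r a : evenM r.+1 a -> mother_group m r a.
Proof.
move=> ra X [sX gX]; elim: ra.
- by apply/set_mem; case: sX.
- by move=> a' b _ /mem_set Xa _ /mem_set Xb; apply/set_mem/group_closedM.
- by move=> a' _ /mem_set Xa; apply/set_mem/group_closedV.
- by move=> j s jr _; apply: gX; left; exists j, s.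
- move=> i s ir ds; apply: gX; right; exists i, s; split=> //.
  by move=> x x0; apply: dtransp_fix ds _; rewrite /nonzero x0.
Qed.

Lemma evenMR k a b : evenM k a -> evenM k b -> evenM k [~ a, b].
Proof.
move=> ka kb.
by repeat first [exact: ka | exact: kb | apply: evenMM | apply: evenMV].
Qed.

Lemma evenMJ k a b : evenM k a -> evenM k b -> evenM k (a ^ b).
Proof.
move=> ka kb.
by repeat first [exact: ka | exact: kb | apply: evenMM | apply: evenMV].
Qed.

Lemma evenM_leq k l a : k <= l -> evenM k a -> evenM l a.
Proof.
move=> kl; elim.
- exact: evenM1.
- by move=> ? ? _ ? _ ?; apply: evenMM.
- by move=> ? _ ?; apply: evenMV.
- by move=> j s /leq_trans/(_ kl) jl ds; apply: evenM_alpha.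
- by move=> j s /leq_trans/(_ kl) jl ds; apply: evenM_beta.
Qed.

Lemma evenM_perm k s : dtransp_prod predT s -> evenM k (alpha 0 s).
Proof.
elim=> [|u v du _ IHv]; first by rewrite alpha1; apply: evenM1.
by rewrite alphaM; apply: evenMM => //; apply: evenM_alpha.
Qed.

Lemma evenM_beta0 k s : dtransp_prod nonzero s -> evenM k.+1 (beta 0 s).
Proof.
elim=> [|u v du _ IHv]; first by rewrite beta1; apply: evenM1.
rewrite betaM; first by apply: evenMM => //; apply: evenM_beta.
by move=> x; apply: dtransp_fix du.
Qed.

(** Seven letters leave six nonzero ones, as many as [dtransp_comm] needs. *)
Hypothesis m7 : 6 < m.

Let zero : 'I_m := Ordinal (leq_trans (isT : 0 < 7) m7).
Let one : 'I_m := Ordinal (leq_trans (isT : 1 < 7) m7).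

Let card_all : 5 < #|@predT 'I_m|.
Proof. by rewrite card_ord ltnW. Qed.

Let card_nonzero : 5 < #|nonzero|.
Proof.
rewrite -ltnS; apply: leq_trans m7 _.
rewrite -[X in X <= _]card_ord -(cardC (pred1 zero)) card1 add1n ltnS.
by apply: subset_leq_card; apply/fintype.subsetP => x; rewrite !inE.
Qed.

(** Two spare points outside [l] turn the transposition of [x] and [y] into a double one; hence the
    four extra points in the bound. *)
Lemma dtransp_move (P : pred 'I_m) (l : seq 'I_m) (x y : 'I_m) :
    size l + 4 <= #|P| -> P x -> P y -> x \notin l -> y \notin l ->
  exists2 s, dtransp_prod P s & s x = y /\ {in l, forall z, s z = z}.
Proof.
move=> lP Px Py xl yl; have [->|xy] := eqVneq x y.
  by exists 1; [left|split=> [|z _]; rewrite perm1].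
have [c Pc nc] : exists2 c, P c & c \notin x :: y :: l.
  by apply: exists_notin => /=; apply: leq_trans lP; rewrite addnC.
have [d Pd nd] : exists2 d, P d & d \notin c :: x :: y :: l.
  by apply: exists_notin => /=; apply: leq_trans lP; rewrite addnC.
move: nc nd; rewrite !inE !negb_or => /and3P[cx cy cl] /and4P[dc dx dy dl].
exists (tperm x y * tperm c d).
  apply: dtransp_prod_gen; exists x, y, c, d; split=> //=.
    rewrite !inE !negb_or xy (eq_sym x c) (eq_sym x d) (eq_sym y c).
    by rewrite (eq_sym y d) (eq_sym c d) cx cy dx dy dc.
  by rewrite Px Py Pc Pd.
split; first by rewrite permM tpermL tpermD.
move=> z zl; have nz u : u \notin l -> u != z by apply: contraNneq => ->.
by rewrite permM !tpermD ?nz.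
Qed.

Lemma evenM_single_move k x y a : evenM k (single x a) -> evenM k (single y a).
Proof.
move=> kx; have [|//|//|//|//|s ds [sx _]] := @dtransp_move predT [::] x y => //.
  by rewrite (leq_trans _ card_all).
have -> : single y a = single x a ^ alpha 0 s.
  rewrite wreathJ; apply: eq_wreath => z.
  by rewrite -sx (can2_eq (permKV s) (permK s)).
by apply: evenMJ kx _; apply: evenM_perm.
Qed.

Let evenM_moved_one k : exists2 s, evenM k (alpha 0 s) &
  [/\ s zero = zero, s one != one & s one != zero].
Proof.
have [y _ ny] : exists2 y : 'I_m, predT y & y \notin [:: zero; one].
  by apply: exists_notin; apply: leq_trans card_all.
move: ny; rewrite !inE negb_or => /andP[yz yo].
have [|//|//|//||s ds [so sz]] := @dtransp_move predT [:: zero] one y => //.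
- by rewrite (leq_trans _ card_all).
- by rewrite inE yz.
by exists s; [apply: evenM_perm|rewrite so sz ?inE].
Qed.

Let evenM_moved_zero k : exists2 s, evenM k (alpha 0 s) &
  [/\ s one = one, s zero != zero & s zero != one].
Proof.
have [y _ ny] : exists2 y : 'I_m, predT y & y \notin [:: zero; one].
  by apply: exists_notin; apply: leq_trans card_all.
move: ny; rewrite !inE negb_or => /andP[yz yo].
have [|//|//|//||s ds [so sz]] := @dtransp_move predT [:: one] zero y => //.
- by rewrite (leq_trans _ card_all).
- by rewrite inE yo.
by exists s; [apply: evenM_perm|rewrite so sz ?inE].
Qed.

Lemma alphaS_ord j s : alpha j.+1 s = wreath (fun x => if x == zero
  then alpha j.+1 s else if x == one then alpha j s else 1) 1.
Proof. by rewrite [LHS]alphaSE; apply: eq_wreath. Qed.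

Lemma betaS_ord k s : beta k.+1 s = wreath (fun x => if x == zero
  then beta k.+1 s else if x == one then beta k s else 1) 1.
Proof. by rewrite [LHS]betaSE; apply: eq_wreath. Qed.

(* Conjugating the second automorphism by a permutation that moves [one] but
   fixes [zero] makes the commutator survive at [zero] only. *)
Lemma evenM_single_comm_zero k (a a' b b' : tree_aut m) :
    evenM k (wreath (fun x =>
      if x == zero then a else if x == one then a' else 1) 1) ->
    evenM k (wreath (fun x =>
      if x == zero then b else if x == one then b' else 1) 1) ->
  evenM k (single zero [~ a, b]).
Proof.
move=> ka kb; have [s ks [sz so soz]] := evenM_moved_one k.
have := evenMR ka (evenMJ kb ks); rewrite wreathJ -(@singleR _ zero).
  by have -> : s^-1 zero = zero by rewrite -[in LHS]sz permK.
move=> y /negPf yz; rewrite yz; case: (eqVneq y one) => [->|]; last by left.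
right; have : s^-1 one != zero by rewrite (can2_eq (permKV s) (permK s)) sz.
have : s^-1 one != one by rewrite (can2_eq (permKV s) (permK s)) eq_sym.
by move=> /negPf -> /negPf ->.
Qed.

Lemma evenM_single_comm_one k (a a' b b' : tree_aut m) :
    evenM k (wreath (fun x =>
      if x == zero then a else if x == one then a' else 1) 1) ->
    evenM k (wreath (fun x =>
      if x == zero then b else if x == one then b' else 1) 1) ->
  evenM k (single one [~ a', b']).
Proof.
move=> ka kb; have [s ks [so sz szo]] := evenM_moved_zero k.
have := evenMR ka (evenMJ kb ks); rewrite wreathJ -(@singleR _ one).
  by have -> : s^-1 one = one by rewrite -[in LHS]so permK.
move=> y /negPf yo; rewrite yo; case: (eqVneq y zero) => [->|]; last by left.
right; have : s^-1 zero != one by rewrite (can2_eq (permKV s) (permK s)) so.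
have : s^-1 zero != zero by rewrite (can2_eq (permKV s) (permK s)) eq_sym.
by move=> /negPf -> /negPf ->.
Qed.

(** Apart from [beta 0], each generator is a commutator of generators of its kind, which the
    commutator lemmas confine to one letter. Root permutations are reached as sections of [alpha 1]
    at [one], whence the positive level. *)
Lemma evenM_single k x a : evenM k.+1 a -> evenM k.+1 (single x a).
Proof.
elim.
- by rewrite single1; apply: evenM1.
- by move=> b c _ kb _ kc; rewrite singleM; apply: evenMM.
- by move=> b _ kb; rewrite singleV; apply: evenMV.
- move=> j s jk /(dtransp_comm card_all)[u [v [du dv ->]]].
  case: j jk => [|j] jk; rewrite alphaR.
    apply: (@evenM_single_move _ one).
    apply: (@evenM_single_comm_one _ (alpha 1 u) _ (alpha 1 v)).
      by rewrite -alphaS_ord; apply: evenM_alpha.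
    by rewrite -alphaS_ord; apply: evenM_alpha.
  apply: (@evenM_single_move _ zero).
  apply: (@evenM_single_comm_zero _ _ (alpha j u) _ (alpha j v)).
    by rewrite -alphaS_ord; apply: evenM_alpha.
  by rewrite -alphaS_ord; apply: evenM_alpha.
- move=> [|i] s ik ds; apply: (@evenM_single_move _ zero).
    suff -> : single zero (beta 0 s) = beta 0 s * (alpha 0 s)^-1.
      apply: evenMM; first exact: evenM_beta.
      apply/evenMV/evenM_alpha => //; case: ds => a' [b [c [d [u _ ->]]]].
      by exists a', b, c, d.
    apply: (@mulIg _ (alpha 0 s));
    rewrite mulgVK alpha0E [RHS]beta0E wreathM mul1g.
    by apply: eq_wreath => y; rewrite mulg1.
  have [u [v [du dv ->]]] := dtransp_comm card_nonzero ds.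
  rewrite betaR; [|by move=> y; apply: dtransp_fix..].
  apply: (@evenM_single_comm_zero _ _ (beta i u) _ (beta i v)).
    by rewrite -betaS_ord; apply: evenM_beta.
  by rewrite -betaS_ord; apply: evenM_beta.
Qed.

Lemma evenM_wreath k f s :
  (forall x, evenM k.+1 (f x)) -> dtransp_prod predT s ->
  evenM k.+1 (wreath f s).
Proof.
move=> kf ds; suff: evenM k.+1 (wreath f 1).
  move=> kw; have -> : wreath f s = wreath f 1 * alpha 0 s.
    by rewrite alpha0E wreathM mul1g; apply: eq_wreath => x; rewrite mulg1.
  by apply: evenMM kw _; apply: evenM_perm.
have: forall l, uniq l ->
    evenM k.+1 (wreath (fun x => if x \in l then f x else 1) 1).
  elim=> [_|x l IHl /= /andP[xl ul]]; first by rewrite wreath1; apply: evenM1.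
  have := evenMM (evenM_single x (kf x)) (IHl ul); rewrite wreathM mulg1.
  congr evenM; apply: eq_wreath => y; rewrite perm1 inE.
  by case: eqVneq => [->|_] /=; rewrite ?(negPf xl) ?mulg1 ?mul1g.
move/(_ _ (enum_uniq 'I_m)); congr evenM.
by apply: eq_wreath => x; rewrite mem_enum.
Qed.

(** For generators these are the recursions of [alpha] and [beta] one level up; they pass to
    products and inverses because the root permutations are trivial. *)
Lemma evenM_shift1 k a : evenM k a -> exists2 b, evenM k.+1 b &
  b = wreath (fun y => if y == zero then b else if y == one then a else 1) 1.
Proof.
elim.
- exists 1; first exact: evenM1.
  by rewrite -[LHS]wreath1; apply: eq_wreath => y; do 2?case: ifP.
- move=> a1 a2 _ [b1 kb1 b1E] _ [b2 kb2 b2E]; exists (b1 * b2).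
    exact: evenMM.
  rewrite {1}b1E {1}b2E wreathM mulg1; apply: eq_wreath => y; rewrite perm1.
  by do 2?case: ifP => _; rewrite ?mulg1.
- move=> a1 _ [b1 kb1 b1E]; exists b1^-1; first exact: evenMV.
  rewrite {1}b1E wreathV; apply: eq_wreath => y.
  by do 2?case: ifP => _; rewrite ?invg1.
- move=> j s jk ds; exists (alpha j.+1 s); first exact: evenM_alpha.
  by rewrite -alphaS_ord.
- move=> j s jk ds; exists (beta j.+1 s); first exact: evenM_beta.
  by rewrite -betaS_ord.
Qed.

Lemma beta0_ord s :
  beta 0 s = wreath (fun x => if x == zero then beta 0 s else 1) s.
Proof. by rewrite {1}beta0E; apply: eq_wreath. Qed.

Lemma dtransp_prod_fix0 s : dtransp_prod nonzero s -> s zero = zero.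
Proof.
elim=> [|u v /dtransp_fix u0 _ v0]; first by rewrite perm1.
by rewrite permM u0.
Qed.

(** Conjugate by [beta 0 s], where [s] fixes [zero] and sends [one] to [x]. As [beta 0 s] recurs at
    [zero], the section there is again the conjugate, so the loop survives; a mere root permutation
    would break it. *)
Lemma evenM_shift k x a : x != zero -> evenM k a -> exists2 b, evenM k.+1 b &
  b = wreath (fun y => if y == zero then b else if y == x then a else 1) 1.
Proof.
move=> xz /evenM_shift1[b kb bE].
have [|//|//|//|//|s ds [so _]] := @dtransp_move nonzero [::] one x => //.
  by rewrite (leq_trans _ card_nonzero).
have sz := dtransp_prod_fix0 ds.
have szE y : (s^-1 y == zero) = (y == zero).
  by rewrite (can2_eq (permKV s) (permK s)) sz.
have kB := evenM_beta0 k ds.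
exists (b ^ beta 0 s); first exact: evenMJ.
apply: (@mulgI _ (beta 0 s)); rewrite {1}conjgE mulVKg {1}bE.
rewrite [X in _ * X = _]beta0_ord [X in _ = X * _]beta0_ord.
rewrite !wreathM mul1g mulg1; apply: eq_wreath => y; rewrite perm1.
have [->|yz] := eqVneq y zero; first by rewrite sz eqxx conjgE mulVKg.
have -> : (s y == zero) = false by rewrite -szE permK (negPf yz).
by rewrite -so (inj_eq perm_inj) mulg1 mul1g.
Qed.

(** A recursion looping at one letter determines the image of every word letter by letter. *)
Lemma wreath_fix_unique f s a b (z : 'I_m) :
    a = wreath (fun x => if x == z then a else f x) s ->
    b = wreath (fun x => if x == z then b else f x) s ->
  a = b.
Proof.
move=> aE bE; apply: tree_autE; elim=> [|x w IHw].
  by case: (tree_autP a) (tree_autP b) => _ -> _ [].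
by rewrite aE bE /=; congr cons; case: eqP.
Qed.

(** The product of the loops given by [evenM_shift] for the nonzero letters carries all the [f x],
    and a last factor [beta 0 s] supplies the root permutation. It satisfies the recursion of [b],
    hence equals [b]. *)
Lemma evenM_loop k f s b (z : 'I_m) : val z = 0%N ->
    (forall x, x != z -> evenM k (f x)) -> dtransp_prod nonzero s ->
    b = wreath (fun x => if x == z then b else f x) s ->
  evenM k.+1 b.
Proof.
move=> z0; have -> : z = zero by apply: val_inj.
move=> kf ds bE; have: forall l, uniq l -> zero \notin l -> exists2 p,
    evenM k.+1 p & p = wreath (fun x => if x == zero then p else
                                  if x \in l then f x else 1) 1.
  elim=> [_ _|x l IHl /= /andP[xl ul]].
    exists 1; first exact: evenM1.
    by rewrite -[LHS]wreath1; apply: eq_wreath => y; case: ifP.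
  rewrite inE eq_sym negb_or => /andP[xz zl].
  have [p kp pE] := IHl ul zl.
  have [q kq qE] := evenM_shift xz (kf x xz).
  exists (q * p); first exact: evenMM.
  rewrite {1}pE {1}qE wreathM mulg1; apply: eq_wreath => y; rewrite perm1 inE.
  have [//|_] := eqVneq y zero.
  by case: eqVneq => [->|_] /=; rewrite ?(negPf xl) ?mulg1 ?mul1g.
case/(_ [seq x <- enum 'I_m | x != zero]).
- by rewrite filter_uniq ?enum_uniq.
- by rewrite mem_filter eqxx.
move=> p kp pE; suff -> : b = p * beta 0 s.
  by apply: evenMM kp _; apply: evenM_beta0.
apply: wreath_fix_unique bE _.
rewrite {1}pE {1}beta0_ord wreathM mul1g; apply: eq_wreath => y; rewrite perm1.
have [//|yz] := eqVneq y zero.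
by rewrite mem_filter yz mem_enum mulg1.
Qed.

End EvenMotherGroup.

(** * Growth of automata *)

Section Sections.
Local Open Scope group_scope.
Variable m : nat.
Implicit Types (g h : tree_aut m) (u v w : word m).

Lemma cat_injr (u v w : word m) : u ++ v = u ++ w -> v = w.
Proof. by elim: u => //= x u IHu [/IHu]. Qed.

Lemma section_cat g u v : section g (u ++ v) = section (section g u) v.
Proof.
apply: tree_autE => w; apply: (@cat_injr (g (u ++ v))).
by rewrite -sectionE -catA sectionE sectionE catA -sectionE.
Qed.

Lemma tree_aut0 g : g [::] = [::].
Proof. by case: (tree_autP g). Qed.

Lemma section_nil g : section g [::] = g.
Proof. by apply: tree_autE => w; rewrite [RHS](sectionE g [::]) tree_aut0. Qed.

Lemma section_one v : section 1 v = 1 :> tree_aut m.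
Proof.
by apply: tree_autE => w; apply: (@cat_injr v); rewrite -(sectionE 1).
Qed.

Lemma sectionM g h v : section (g * h) v = section g v * section h (g v).
Proof.
apply: tree_autE => w; apply: (@cat_injr ((g * h) v)).
by rewrite -sectionE -[LHS]/(h (g (v ++ w))) !sectionE.
Qed.

Lemma section_power g u t :
  section g u = g -> section g (flatten (nseq t u)) = g.
Proof.
by move=> gu; elim: t => [|t IHt]; rewrite ?section_nil //= section_cat gu.
Qed.

Definition finitary g := exists n, forall v, size v = n -> section g v = 1.

Lemma finitary_leq g n v :
    (forall v, size v = n -> section g v = 1) -> n <= size v ->
  section g v = 1.
Proof.
move=> gn nv; rewrite -(cat_take_drop n v) section_cat gn ?section_one //.
by rewrite size_takel.
Qed.

Lemma nonfinitary_child g : ~ finitary g ->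
  exists x, ~ finitary (section g [:: x]).
Proof.
apply: contra_notP => /forallNP h.
have {}h x : finitary (section g [:: x]) by apply: contrapT.
have [f fP] := choice h; exists (\max_x f x).+1 => -[|x v] // [sv].
rewrite -cat1s section_cat; apply: finitary_leq (fP x) _.
by rewrite sv (leq_bigmax x).
Qed.

(* Unlike the number of nontrivial sections, this number does not decrease
   with [n]. *)
Fixpoint nonfinitary_sections g n : nat :=
  if n is n'.+1 then \sum_(x < m) nonfinitary_sections (section g [:: x]) n'
  else ~~ `[< finitary g >].
Notation nf := nonfinitary_sections.

(** Over a finite alphabet a non-finitary automorphism has a non-finitary child. *)
Lemma nf_leq g n p : n <= p -> nf g n <= nf g p.
Proof.
move=> /subnK <-; elim: (p - n) => // {p}p IHp; apply: leq_trans IHp _.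
rewrite addSn; elim: {n p}(p + n) g => [|n IHn] g.
  rewrite [X in X <= _]/=; case: asboolP => // /nonfinitary_child[x /asboolPn gx].
  by rewrite /= (bigD1 x) //= gx.
by rewrite [X in X <= _]/= [X in _ <= X]/=; apply: leq_sum => x _; apply: IHn.
Qed.

Lemma nf_section g y n : nf (section g y) n <= nf g (size y + n).
Proof.
elim: y g => [|x y IHy] g; first by rewrite section_nil.
rewrite -cat1s section_cat /= (bigD1 x) //=.
exact: leq_trans (IHy _) (leq_addr _ _).
Qed.

(** Being no prefix of [w] and no longer than it, [y] heads a disjoint subtree; that subtree is read
    at least [n] levels deep, which can only raise its count. *)
Lemma nf_two_sections g w y n : size y <= size w -> y != take (size y) w ->
  nf (section g w) n + nf (section g y) n <= nf g (size w + n).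
Proof.
elim: y w g => [|x y IHy] [|z w] g //=.
rewrite ltnS eqseq_cons negb_and => yw.
rewrite -[x :: y]cat1s -[z :: w]cat1s !section_cat.
case: (eqVneq x z) => [<- /= yNw|xz _]; rewrite (bigD1 x) //=.
  exact: leq_trans (IHy _ _ yw yNw) (leq_addr _ _).
rewrite (bigD1 z) 1?eq_sym //= addnC; apply: leq_add.
  apply: leq_trans (nf_section _ _ _) _.
  by apply: nf_leq; rewrite leq_add2r.
exact: leq_trans (nf_section _ _ _) (leq_addr _ _).
Qed.

Lemma nf_le_nontrivial g n : nf g n <= nontrivial_sections g n.
Proof.
elim: n g => [|n IHn] g /=.
  case: asboolP => // gNfin; apply/card_gt0P; exists [tuple]; rewrite !inE /=.
  apply/eqP => g1; apply: gNfin; exists 0 => v _.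
  by rewrite -[g]section_nil g1 section_one.
apply: (@leq_trans (\sum_x nontrivial_sections (section g [:: x]) n)).
  exact: leq_sum.
rewrite /nontrivial_sections.
under eq_bigr do rewrite -sum1_card.
rewrite pair_big_dep /= sum1dep_card.
pose c (p : 'I_m * n.-tuple 'I_m) := cons_tuple p.1 p.2.
have c_inj : injective c.
  by move=> [x v] [y w] /(congr1 val) /= [-> /val_inj ->].
rewrite -(fintype.card_image c_inj); apply: subset_leq_card.
apply/fintype.subsetP => v /fintype.imageP[[x w]]; rewrite !inE /= => gxw ->.
by rewrite /= -cat1s section_cat.
Qed.

(* [growth_bound k.+1] is a bound by a multiple of [n ^ k], and
   [growth_bound 0] means finitary. *)
Definition growth_bound k g :=
  exists C, forall n, (n.+1 * nf g n <= C * n.+1 ^ k)%N.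

Local Open Scope nat_scope.

Lemma growth_bound0 g : growth_bound 0 g -> finitary g.
Proof.
move=> [C gC]; apply: contrapT => /asboolPn gNfin.
have := gC C; rewrite expn0 muln1 leqNgt => /negP; apply.
by rewrite (leq_trans _ (leq_mul (leqnn _) (nf_leq g (leq0n C)))) //= gNfin muln1.
Qed.

Lemma growth_bound_section k g y :
  growth_bound k g -> growth_bound k (section g y).
Proof.
(* The extra factor pays for size y + n + 1 <= (size y + 1)(n + 1). *)
move=> [C gC]; exists (C * (size y).+1 ^ k) => n.
apply: (@leq_trans ((size y + n).+1 * nf g (size y + n))).
  by apply: leq_mul (nf_section _ _ _); rewrite ltnS leq_addl.
apply: leq_trans (gC _) _; rewrite -mulnA -expnMn leq_mul2l.
apply/orP; right; case: k {gC} => // k; rewrite leq_exp2r //; nia.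
Qed.

(* Each turn of the loop [w] at [e] adds the sections of [e] at [y] to the
   count for [e], so that the growth of [section e y] is of smaller degree. *)
Lemma growth_bound_off_loop d e w y :
    growth_bound d.+1 e -> section e w = e ->
    size y <= size w -> y != take (size y) w ->
  growth_bound d (section e y).
Proof.
move=> [C eC] ew yw yNw; pose T := size w.
have iter_loop j n : j * nf (section e y) n <= nf e (n + j * T).
  elim: j => // j IHj; rewrite mulSn addnC.
  have -> : n + j.+1 * T = size w + (n + j * T) by rewrite mulSn addnCA.
  apply: leq_trans (nf_two_sections _ _ yw yNw); rewrite ew.
  by apply: leq_add IHj _; apply: nf_leq; rewrite leq_addr.
(* After n+1 turns of the loop the level plus one is (n+1)(T+1); this factor cancels from the bound
   for [e] and lowers the exponent by one. *)
exists (C * T.+1 ^ d) => n; apply: leq_trans (iter_loop _ _) _.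
have := eC (n + n.+1 * T).
have -> : (n + n.+1 * T).+1 = n.+1 * T.+1 by rewrite mulnS.
by rewrite expnS mulnCA leq_pmul2l // expnMn -mulnA [X in C * X]mulnC.
Qed.

(* The pigeonhole principle puts a loop on the path read along [x]; as the
   degree does not drop, the rest of [x] winds around that loop. *)
Lemma section_on_loop (s : seq (tree_aut m)) a d N x :
    (forall b y, b \in s -> section b [:: y] \in s) ->
    (forall L, 0 < L <= size s -> L %| N) -> size s <= N ->
    a \in s -> growth_bound d.+1 a -> size x = N ->
    ~ growth_bound d (section a x) ->
  exists2 u, size u = N & section (section a x) u = section a x.
Proof.
move=> sS divN sN as_ ad xN axNd.
have s_sec y : section a y \in s.
  elim/last_ind: y => [|y z IHy]; first by rewrite section_nil.
  by rewrite -cats1 section_cat sS.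
pose st i := section a (take i x).
have : ~~ uniq (map st (iota 0 (size s).+1)).
  apply/negP => us.
  have /(uniq_leq_size us) : {subset map st (iota 0 (size s).+1) <= s}.
    by move=> _ /mapP[i _ ->]; apply: s_sec.
  by rewrite size_map size_iota ltnn.
move=> /(uniqPn 1%g)[i [j [ij]]]; rewrite size_map size_iota ltnS => js.
rewrite !(nth_map 0) ?size_iota ?ltnS ?(leq_trans (ltnW ij)) //.
rewrite !nth_iota ?ltnS ?(leq_trans (ltnW ij)) // !add0n /st.
set e := section a (take i x) => eE.
pose w := drop i (take j x).
have jx : j <= size x by rewrite xN (leq_trans js).
have wL : size w = j - i by rewrite size_drop size_takel.
have ew : section e w = e.
  have : take i x ++ w = take j x.
    by rewrite -[RHS](cat_take_drop i) take_takel // ltnW.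
  by move=> iwj; rewrite [RHS]eE -iwj section_cat.
have wN : (j - i) %| N.
  by apply: divN; rewrite subn_gt0 ij (leq_trans (leq_subr _ _)).
(* Loops of any length j - i are repeated up to the common length N. *)
pose W := flatten (nseq (N %/ (j - i)) w).
have WN : size W = N.
  by rewrite size_flatten /shape map_nseq sumn_nseq wL mulnC divnK.
have eW : section e W = e by apply: section_power.
pose y := drop i x.
have exE : section a x = section e y by rewrite /e -section_cat cat_take_drop.
have yW : size y <= size W by rewrite WN size_drop xN leq_subr.
(* Leaving the loop would lower the degree, which is excluded. *)
have yE : y = take (size y) W.
  apply/eqP/negPn/negP => yNW; apply: axNd; rewrite exE.
  by apply: growth_bound_off_loop yW yNW => //; apply: growth_bound_section.
(* The loop is rotated: the rest of [W] leads back to [e], then [y] is read again. *)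
exists (drop (size y) W ++ y).
  by rewrite size_cat size_drop addnC subnKC.
by rewrite exE section_cat -(section_cat e) {1}yE cat_take_drop eW.
Qed.

Import Order.TTheory GRing.Theory Num.Theory.

Lemma nf_le_exp g n : nf g n <= m ^ n.
Proof.
apply: leq_trans (nf_le_nontrivial g n) _.
by apply: leq_trans (max_card _) _; rewrite card_tuple card_ord.
Qed.

Lemma has_degree_growth_bound r g e :
  (e <= (r%:Z)%:E)%E -> has_degree g e -> growth_bound r.+1 g.
Proof.
move=> er ge; suff [C [n0 gC]] : exists C n0, forall n, n0 <= n ->
    nontrivial_sections g n <= C * n.+1 ^ r.
  (* The first summand bounds the levels from [n0] on, the second the earlier ones, where the count
     is at most m^n. *)
  exists (C + m.+1 ^ n0) => n; rewrite expnS mulnCA leq_pmul2l // mulnDl.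
  have [/gC n0n|nn0] := leqP n0 n.
    exact: leq_trans (nf_le_nontrivial _ _) (leq_trans n0n (leq_addr _ _)).
  apply: leq_trans (nf_le_exp _ _) (leq_trans _ (leq_addl _ _)).
  apply: (@leq_trans (m.+1 ^ n0)); last by rewrite leq_pmulr // expn_gt0.
  apply: (@leq_trans (m.+1 ^ n)); last by apply: leq_pexp2l => //; apply: ltnW.
  by case: n {nn0} => // n; rewrite leq_exp2r.
case: ge er => [n0 g0|d c C n0 _ C0 gC|//] er.
  by exists 0, n0 => n /g0 ->.
have {er} dr : d <= r by move: er; rewrite lee_fin lez_nat.
exists (Num.truncn C).+1, n0 => n /gC/andP[_ nC].
rewrite -(ler_nat rat) (le_trans nC) // natrM.
apply: ler_pM => //; first exact: ltW.
- by rewrite exprn_ge0 // ler0n.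
- by rewrite ltW // truncnS_gt.
- rewrite -natrX ler_nat; apply: (@leq_trans (n.+1 ^ d)).
    by case: (d) => // d'; rewrite leq_exp2r.
  by rewrite leq_pexp2l.
Qed.

End Sections.

(** * Recoding *)

Section PermInduction.
Local Open Scope group_scope.

(** Split off the transposition of a moved point with its image: neither lies in [F], and fewer
    points remain moved. *)
Lemma tperm_ind (T : finType) (F : pred T) (Q : {perm T} -> Prop) : Q 1 ->
    (forall s t, Q s -> Q t -> Q (s * t)) ->
    (forall a b, a != b -> ~~ F a -> ~~ F b -> Q (tperm a b)) ->
  forall s : {perm T}, (forall x, F x -> s x = x) -> Q s.
Proof.
move=> Q1 QM Qt s; have [n] := ubnP #|[pred x | s x != x]|.
elim: n s => // n IHn s; rewrite ltnS => sn sF.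
have [x /eqP sx|sid] := pickP (fun x => s x != x); last first.
  suff -> : s = 1 by [].
  by apply/permP => x; rewrite perm1; apply/eqP/negPn; rewrite sid.
have [xs ssx] : x != s x /\ s (s x) != s x.
  by rewrite (inj_eq perm_inj) eq_sym; split; apply/eqP.
have NF y : s y != y -> ~~ F y by move=> sy; apply: contra_neqN sy => /sF.
have -> : s = tperm x (s x) * (tperm x (s x) * s) by rewrite mulgA tperm2 mul1g.
apply: QM; first by apply: Qt => //; apply: NF => //; rewrite eq_sym.
apply: IHn; last first.
  move=> y Fy; rewrite permM; case: tpermP => [yx|yx|_ _]; last exact: sF.
    by move: Fy; rewrite yx (negPf (NF x _)) // eq_sym.
  by move: Fy; rewrite yx (negPf (NF _ ssx)).
apply: leq_trans sn; apply: proper_card; apply/properP; split.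
  apply/fintype.subsetP => y; rewrite !inE permM.
  by case: tpermP => [->|->|//]; rewrite ?eqxx // (eq_sym (s x) x) xs.
by exists (s x); rewrite !inE // permM tpermR negbK.
Qed.

End PermInduction.

Section Encoding.
Local Open Scope group_scope.
Variables (m0 N : nat).
Hypothesis m0_gt1 : 1 < m0.
Hypothesis N_gt0 : 0 < N.

Notation Z := ((N + N).-tuple 'I_m0).
Let z0 : Z := nseq_tuple _ (Ordinal (ltnW m0_gt1)).

Definition code_size := #|{: Z * bool}|.
Notation m := code_size.

Lemma code_size_gt6 : 6 < m.
Proof.
rewrite /m card_prod card_bool card_tuple card_ord muln2 (@leq_trans 4.*2) //.
rewrite leq_double (@leq_trans (2 ^ (N + N))) //.
  by rewrite (@leq_exp2l 2 2) // addnn (leq_double 1).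
by rewrite leq_exp2r // addn_gt0 N_gt0.
Qed.

Let ord_z : 'I_m := Ordinal (leq_trans (isT : 0 < 7) code_size_gt6).

(** The transposition gives [(z0, false)] the letter 0, at which the generators loop. *)
Let enc (y : Z * bool) : 'I_m :=
  tperm (enum_rank (z0, false)) ord_z (enum_rank y).
Let dec (i : 'I_m) : Z * bool :=
  enum_val (tperm (enum_rank (z0, false)) ord_z i).

Let encK : cancel enc dec.
Proof. by move=> y; rewrite /dec /enc tpermK enum_rankK. Qed.

Let decK : cancel dec enc.
Proof. by move=> i; rewrite /dec /enc enum_valK tpermK. Qed.

Let enc_z0 : val (enc (z0, false)) = 0%N.
Proof. by rewrite /enc tpermL. Qed.

Let dbl_inj (t : {perm Z}) : injective (fun i => enc (t (dec i).1, (dec i).2)).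
Proof.
move=> i j /(can_inj encK)[/perm_inj e1 e2]; apply: (can_inj decK).
by case: (dec i) (dec j) e1 e2 => [? ?] [? ?] /= -> ->.
Qed.
Let dbl t : 'S_m := perm (@dbl_inj t).

Let dblE t z b : dbl t (enc (z, b)) = enc (t z, b).
Proof. by rewrite permE encK. Qed.

Let dbl1 : dbl 1 = 1.
Proof.
by apply/permP => i; rewrite -[i]decK; case: (dec i) => z b; rewrite dblE !perm1.
Qed.

Let dblM s t : dbl (s * t) = dbl s * dbl t.
Proof.
apply/permP => i; rewrite -[i]decK; case: (dec i) => z b.
by rewrite permM !dblE permM.
Qed.

Let dbl_tperm a b : dbl (tperm a b) =
  tperm (enc (a, false)) (enc (b, false)) * tperm (enc (a, true)) (enc (b, true)).
Proof.
have ncE (x y : Z) c d : (enc (x, c) == enc (y, d)) = ((x, c) == (y, d)).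
  exact: (inj_eq (can_inj encK)).
have same (z : Z) c :
    tperm (enc (a, c)) (enc (b, c)) (enc (z, c)) = enc (tperm a b z, c).
  case: (tpermP a b z) => [->|->|/eqP za /eqP zb]; rewrite ?tpermL ?tpermR //.
  by rewrite tpermD // ncE xpair_eqE eqxx andbT eq_sym.
have other (z : Z) c :
    tperm (enc (a, ~~ c)) (enc (b, ~~ c)) (enc (z, c)) = enc (z, c).
  by rewrite tpermD // ncE xpair_eqE; case: c; rewrite andbF.
apply/permP => i; rewrite -[i]decK; case: (dec i) => z c; rewrite dblE permM.
by case: c; [rewrite (other _ true) same|rewrite same (other _ false)].
Qed.

Let dtransp_dbl (P : pred 'I_m) a b : a != b ->
  (forall c, P (enc (a, c))) -> (forall c, P (enc (b, c))) ->
  dtransp_prod P (dbl (tperm a b)).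
Proof.
move=> ab Pa Pb; apply: dtransp_prod_gen.
exists (enc (a, false)), (enc (b, false)), (enc (a, true)), (enc (b, true)).
split; last exact: dbl_tperm; last by rewrite /= !Pa !Pb.
rewrite /= !inE !(inj_eq (can_inj encK)) !xpair_eqE !andbF !andbT.
by rewrite (negPf ab) orbF.
Qed.

Let dbl_even t : dtransp_prod predT (dbl t).
Proof.
apply: (@tperm_ind _ pred0 (fun t => dtransp_prod predT (dbl t))) => //.
- by rewrite dbl1; left.
- by move=> s u ds du; rewrite dblM; apply: dtransp_prod_mul.
- by move=> a b ab _ _; apply: dtransp_dbl.
Qed.

Let dbl_even0 (t : {perm Z}) : t z0 = z0 -> dtransp_prod (@nonzero m) (dbl t).
Proof.
move=> tz; apply: (@tperm_ind _ (pred1 z0)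
    (fun t => dtransp_prod (@nonzero m) (dbl t))) => [||a b ab|x /eqP->//].
- by rewrite dbl1; left.
- by move=> s u ds du; rewrite dblM; apply: dtransp_prod_mul.
- move=> az bz; have nz x c : x != z0 -> nonzero (enc (x, c)).
    move=> xz; apply/eqP; rewrite -enc_z0 => /val_inj /(can_inj encK)[/eqP].
    by rewrite (negPf xz).
  by apply: dtransp_dbl => // c; apply: nz.
Qed.

Implicit Types (g h : tree_aut m0) (p q : word m0) (w : word m).

Let blk_size g (t : Z) : size (g t) == (N + N)%N.
Proof. by rewrite tree_aut_size size_tuple. Qed.

Let blk_inj g : injective (fun t : Z => Tuple (blk_size g t)).
Proof. by move=> s t /(congr1 val) /= /(bij_inj (tree_aut_bij g)) /val_inj. Qed.
Let blk g : {perm Z} := perm (@blk_inj g).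

Let blkE g (t : Z) : blk g t = g t :> word m0.
Proof. by rewrite permE. Qed.

(* The next block predicted from the suffix [p] of the previous one is [p ++ p];
   [lam p] exchanges it with the block coded by the letter 0. *)
Let lam p : {perm Z} := tperm (insubd z0 (p ++ p)) z0.

Let lamK p : involutive (lam p).
Proof. exact: tpermK. Qed.

(** [p] and [q] are the suffixes of the preceding input and output blocks, used to decode the input
    letter and to encode the output letter. In a product the middle labels cancel. *)
Fixpoint code_fun g p q w : word m :=
  if w is i :: w' then
    let x := lam p (dec i).1 in
    enc (lam q (blk g x), (dec i).2) ::
      (if (dec i).2 then w'
       else code_fun (section g x) (drop N x) (drop N (g x)) w')
  else [::].

Let code_funM g h p q r w :
  code_fun h q r (code_fun g p q w) = code_fun (g * h) p r w.
Proof.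
elim: w g h p q r => //= i w IHw g h p q r; rewrite encK /= lamK.
congr (enc (lam r _, _) :: _); first by apply: val_inj; rewrite /= !blkE.
by case: ((dec i).2) => //; rewrite sectionM !blkE IHw.
Qed.

Let code_fun1 p w : code_fun 1 p p w = w.
Proof.
elim: w p => //= i w IHw p; rewrite section_one IHw if_same.
have -> : blk 1 (lam p (dec i).1) = lam p (dec i).1.
  by apply: val_inj; rewrite /= blkE.
by rewrite lamK -surjective_pairing decK.
Qed.

Lemma code_subproof g p q : is_tree_aut (code_fun g p q).
Proof.
apply: is_tree_autP.
- by exists (code_fun g^-1 q p) => w; rewrite code_funM ?mulgV ?mulVg code_fun1.
- by move=> w; elim: w g p q => //= i w IHw g p q; case: ifP; rewrite ?IHw.
- move=> v w; elim: v g p q => [|i v IHv] g p q /=; first by rewrite take0.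
  by case: ifP; rewrite ?take_size_cat ?IHv.
Qed.
Definition code g p q := TreeAut (code_subproof g p q).

Lemma codeM g h p q r : code (g * h) p r = code g p q * code h q r.
Proof. by apply: tree_autE => w; rewrite /= code_funM. Qed.

Lemma code1 p : code 1 p p = 1.
Proof. by apply: tree_autE => w; apply: code_fun1. Qed.

(** Letters of the first copy reveal [g] block by block; other words are padded to a multiple of the
    block length. *)
Lemma code_inj p q : injective (fun g => code g p q).
Proof.
suff blocks k g h u : (forall w, code_fun g p q w = code_fun h p q w) ->
    size u = (k * (N + N))%N -> g u = h u.
  move=> g h gh; apply: tree_autE => u.
  pose v := nseq (size u * (N + N) - size u) (Ordinal (ltnW m0_gt1)).
  rewrite -(tree_aut_cat g u v) -(tree_aut_cat h u v); congr take.
  apply: (blocks (size u)).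
    by move=> w; have := congr1 (fun a : tree_aut m => a w) gh.
  by rewrite size_cat size_nseq subnKC // leq_pmulr // addn_gt0 N_gt0.
elim: k g h u p q => [|k IHk] g h u p q gh uk.
  by move/size0nil: uk => ->; rewrite !tree_aut0.
have xN : size (take (N + N) u) == (N + N)%N.
  by rewrite size_takel // uk mulSn leq_addr.
pose x : Z := Tuple xN; pose i := enc (lam p x, false).
have gx : g x = h x.
  have := gh [:: i]; rewrite /= encK /= lamK => -[/(can_inj encK)[/perm_inj]].
  by move=> ghx; rewrite -(blkE g x) ghx blkE.
rewrite -[u](cat_take_drop (N + N)) !(sectionE _ (val x)) gx; congr (_ ++ _).
apply: (IHk _ _ _ (drop N x) (drop N (h x))).
  move=> w; have := gh (i :: w).
  by rewrite /= encK /= lamK gx => -[_].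
by rewrite size_drop uk mulSn addKn.
Qed.

Let code_state g p (i : 'I_m) : tree_aut m :=
  if (dec i).2 then 1
  else code (section g (lam p (dec i).1)) (drop N (lam p (dec i).1))
         (drop N (g (lam p (dec i).1))).

Let codeE g p q :
  code g p q = wreath (code_state g p) (dbl (lam p * blk g * lam q)).
Proof.
apply: tree_autE => -[|i w] //=; congr cons; first by rewrite [RHS]permE !permM.
by rewrite /code_state; case: ifP.
Qed.

Section States.
Variable s : seq (tree_aut m0).
Hypothesis s_section : forall a x, a \in s -> section a [:: x] \in s.
Hypothesis s_size : size s <= N.
Hypothesis s_period : forall L, 0 < L <= size s -> (L %| N)%N.
Hypothesis s_finitary : forall a v, a \in s -> finitary a -> size v = N ->
  section a v = 1.

Let s_sections a y : a \in s -> section a y \in s.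
Proof.
move=> sa; elim/last_ind: y => [|y z IHy]; first by rewrite section_nil.
by rewrite -cats1 section_cat s_section.
Qed.

(** The first half of a block exhausts a finitary state, so the second half is unchanged. Input and
    output suffixes then agree, and the recoded sections are trivial. *)
Let evenM_code_finitary a p q : a \in s -> finitary a -> evenM 0 (code a p q).
Proof.
move=> sa fa; rewrite codeE; suff -> : code_state a p = fun=> 1.
  by rewrite -alpha0E; apply/evenM_perm/dbl_even.
apply/funext => i; rewrite /code_state; case: ifP => // _.
set x := lam p _; have xN : size (take N x) = N.
  by rewrite size_takel // size_tuple leq_addr.
have x1 := s_finitary sa fa xN.
rewrite -{1}(cat_take_drop N x) section_cat x1 section_one.
have -> : drop N (a x) = drop N x; last exact: code1.
rewrite -{1}(cat_take_drop N x) sectionE x1 drop_size_cat //.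
by rewrite tree_aut_size.
Qed.

Section Step.
Variable d : nat.
Hypothesis IHd : forall a p q, a \in s -> growth_bound d a -> evenM d (code a p q).

Section Loop.
Variables (a : tree_aut m0) (u : word m0).
Hypothesis sa : a \in s.
Hypothesis ad : growth_bound d.+1 a.
Hypothesis uN : size u = N.
Hypothesis au : section a u = a.

Let uuN : size (u ++ u) == (N + N)%N.
Proof. by rewrite size_cat uN. Qed.
Let uu : Z := Tuple uuN.

Let insubd_uu : insubd z0 (u ++ u) = uu.
Proof. by apply: val_inj; rewrite val_insubd uuN. Qed.

Let a_uu : a uu = a u ++ a u.
Proof. by rewrite /= sectionE au. Qed.

Let sa_uu : section a uu = a.
Proof. by rewrite section_cat au. Qed.

Let evenM_code_off (x : Z) p q : x != uu -> evenM d (code (section a x) p q).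
Proof.
move=> xu; apply: IHd; first exact: s_sections.
apply: growth_bound_off_loop ad sa_uu _ _; first by rewrite !size_tuple.
by rewrite take_oversize ?size_tuple.
Qed.

(** Given these suffixes, the letter 0 codes [u ++ u] on input and its image [a u ++ a u] on output.
    So the root permutation fixes 0, the section there is the automorphism itself, and the other
    sections have lower level. *)
Let evenM_code_loop : evenM d.+1 (code a u (a u)).
Proof.
pose z := enc (z0, false).
apply: (@evenM_loop _ code_size_gt6 d (code_state a u)
         (dbl (lam u * blk a * lam (a u))) _ z enc_z0).
- move=> i iz; rewrite /code_state.
  case: ifP => [_|i2]; first exact: evenM1.
  apply: evenM_code_off; apply: contraNneq iz => /(canRL (lamK u)) i1.
  rewrite -[i]decK (surjective_pairing (dec i)) i1 i2 /z.
  by rewrite /lam insubd_uu tpermL.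
- apply: dbl_even0; rewrite !permM {1}/lam tpermR insubd_uu.
  have -> : blk a uu = insubd z0 (a u ++ a u).
    by apply: val_inj; rewrite /= blkE val_insubd a_uu size_cat tree_aut_size uN eqxx.
  by rewrite /lam tpermL.
- rewrite {1}codeE; apply: eq_wreath => i; case: eqP => // ->.
  rewrite /code_state encK /= /lam tpermR insubd_uu sa_uu a_uu /=.
  by rewrite !drop_size_cat ?tree_aut_size.
Qed.

Lemma evenM_code_periodic p q : evenM d.+1 (code a p q).
Proof.
rewrite codeE; apply: (evenM_wreath code_size_gt6) (dbl_even _) => i.
rewrite /code_state; case: ifP => _; first exact: evenM1.
have [->|xu] := eqVneq (lam p (dec i).1) uu; last first.
  by apply: evenM_leq (evenM_code_off _ _ xu).
rewrite sa_uu a_uu !drop_size_cat ?tree_aut_size //; exact: evenM_code_loop.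
Qed.

End Loop.

(** Either the degree drops within the block, or the second half of the block ends on a loop and
    leads to a state with a period of length N. *)
Lemma evenM_code_step a p q :
  a \in s -> growth_bound d.+1 a -> evenM d.+1 (code a p q).
Proof.
move=> sa ad; rewrite codeE; apply: (evenM_wreath code_size_gt6) (dbl_even _) => i.
rewrite /code_state; case: ifP => _; first exact: evenM1.
set x := lam p _; have [xd|] := pselect (growth_bound d (section a x)).
  by apply: evenM_leq (leqnSn d) _; apply: IHd xd; apply: s_sections.
rewrite -{1 2}(cat_take_drop N x) section_cat => xd.
have sx : section a (take N x) \in s by apply: s_sections.
have xd1 : growth_bound d.+1 (section a (take N x)).
  exact: growth_bound_section.
have x2N : size (drop N x) = N by rewrite size_drop size_tuple addnK.
have [u uN xu] := section_on_loop s_section s_period s_size sx xd1 x2N xd.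
apply: (evenM_code_periodic _ _ uN xu); first exact: s_sections.
exact: growth_bound_section.
Qed.

End Step.

Lemma evenM_code k a p q : a \in s -> growth_bound k a -> evenM k (code a p q).
Proof.
elim: k a p q => [|k IHk] a p q sa ak; last exact: evenM_code_step.
exact: evenM_code_finitary (growth_bound0 ak).
Qed.

End States.

End Encoding.

(** * Embedding the automaton group by recoding *)

Theorem theorem5p1 (r m0 : nat) (hm0 : (2 <= m0)%N) (A : set (tree_aut m0))
    (hA : is_automaton A) (hr : automaton_has_degree A (r%:Z)%:E) :
  exists m : nat, (2 <= m)%N /\
    exists H : set (tree_aut m),
      [/\ is_subgroup H,
          (H `<=` mother_group m r)%classic
        & isomorphic_subgroups (generated_subgroup A) H].
Proof.
have [/finite_seqP[s sA] A_section] := hA; have [_ A_degree] := hr.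
have /choice[f fP] (a : tree_aut m0) : exists n, finitary a ->
    forall v : word m0, size v = n -> section a v = 1%g.
  by have [[n an]|na] := pselect (finitary a); [exists n|exists 0].
(* [c] exceeds the number of states and the depths of the finitary ones; its factorial is at least
   [c] and a multiple of every possible loop length. *)
pose c := (size s + \max_(a <- s) f a).+1; pose N := c`!.
have cN : c <= N by apply: dvdn_leq; rewrite ?fact_gt0 // dvdn_fact /=.
have N_gt0 : 0 < N by apply: fact_gt0.
(* No block precedes the first one: for the empty suffix [insubd] returns its default [z0], so
   nothing is relabelled at the root. *)
pose phi g := code hm0 N_gt0 g [::] [::].
have phiM : {morph phi : g h / (g * h)%g} by move=> g h; apply: codeM.
have phi1 : phi 1%g = 1%g by apply: code1.
have phiV g : phi (g^-1)%g = ((phi g)^-1)%g.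
  by symmetry; apply: mulg1_eq; rewrite -phiM mulgV.
have As a : A a <-> a \in s by rewrite sA.
have phiA a : A a -> mother_group _ r (phi a).
  move=> /[dup] Aa /As sa.
  apply: evenM_mother; apply: evenM_code sa _ => //.
  - by move=> b x /As/A_section sb; apply/As.
  - by apply: leq_trans cN; rewrite ltnW // ltnS leq_addr.
  - move=> L /andP[L0 Ls]; rewrite dvdn_fact // L0 (leq_trans Ls) //.
    by rewrite ltnW // ltnS leq_addr.
  - move=> b v sb fb vN; apply: finitary_leq (fP b fb) _; rewrite vN.
    apply: leq_trans cN; rewrite ltnW // ltnS.
    by rewrite (leq_trans _ (leq_addl _ _)) // leq_bigmax_seq.
  - by have [e ae er] := A_degree a Aa; apply: has_degree_growth_bound ae.
have genP : is_subgroup (generated_subgroup A).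
  split; first by apply/mem_set => X [[/set_mem X1 _] _].
  move=> g h /set_mem gA /set_mem hA'; apply/mem_set => X XA.
  by case: (XA) => -[_ XV] _; apply/set_mem/XV; apply/mem_set; [apply: gA|apply: hA'].
exists (code_size m0 N); split; first exact: leq_trans (code_size_gt6 hm0 N_gt0).
exists (phi @` generated_subgroup A)%classic; split.
- case: genP => G1 GV; split.
    by apply/mem_set; exists 1%g; rewrite ?phi1 //; apply: set_mem.
  move=> _ _ /set_mem[g /mem_set gA <-] /set_mem[h /mem_set hA' <-].
  apply/mem_set.
  by exists (g * h^-1)%g; [apply/set_mem/GV|rewrite phiM phiV].
- move=> _ [g gA <-] X [Xsub genX].
  (* The preimage of [X] under [phi] is a subgroup containing [A]. *)
  apply: (gA (fun g => X (phi g))); split; last first.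
    by move=> a /phiA; apply.
  case: Xsub => X1 XV; split.
    by apply/mem_set; rewrite /= phi1; apply: set_mem.
  move=> g1 g2 /set_mem Xg1 /set_mem Xg2; apply/mem_set => /=.
  by rewrite phiM phiV; apply/set_mem/XV; apply/mem_set.
- exists phi; first by move=> g h _ _; apply: phiM.
  split=> [g gA|g h _ _ /code_inj//|//]; by exists g.
Qed.
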